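(* Let $S$ be a monoid, $\lambda$ any non-zero cardinal and $n$ a positive integer with $n\leqslant\lambda$. Let $$\alpha_S=\begin{pmatrix} a_1&\cdots&a_i\\ s_1&\cdots&s_i\\ b_1&\cdots&b_i\end{pmatrix},\qquad \beta_S=\begin{pmatrix} c_1&\cdots&c_i\\ t_1&\cdots&t_i\\ d_1&\cdots&d_i\end{pmatrix}$$ be non-zero elements of the semigroup $\mathscr{I}_\lambda^n(S)$. Then the following conditions hold: (i) $\alpha_S\mathscr{R}\beta_S$ in $\mathscr{I}_\lambda^n(S)$ if and only if there exists a permutation $\sigma$ of $\{1,\ldots,i\}$ such that $a_1=c_{(1)\sigma},\ldots,a_i=c_{(i)\sigma}$ and $s_1\mathscr{R}t_{(1)\sigma},\ldots,s_i\mathscr{R}t_{(i)\sigma}$ in $S$; (ii) $\alpha_S\mathscr{L}\beta_S$ in $\mathscr{I}_\lambda^n(S)$ if and only if there exists a permutation $\sigma$ of $\{1,\ldots,i\}$ such that $b_1=d_{(1)\sigma},\ldots,b_i=d_{(i)\sigma}$ and $s_1\mathscr{L}t_{(1)\sigma},\ldots,s_i\mathscr{L}t_{(i)\sigma}$ in $S$; (iii) $\alpha_S\mathscr{D}\beta_S$ in $\mathscr{I}_\lambda^n(S)$ if and only if there exists a permutation $\sigma$ of $\{1,\ldots,i\}$ such that $s_1\mathscr{D}t_{(1)\sigma},\ldots,s_i\mathscr{D}t_{(i)\sigma}$ in $S$; (iv) $\alpha_S\mathscr{H}\beta_S$ in $\mathscr{I}_\lambda^n(S)$ if and only if there exist permutations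 $\sigma,\rho$ of $\{1,\ldots,i\}$ such that $s_1\mathscr{R}t_{(1)\sigma},\ldots,s_i\mathscr{R}t_{(i)\sigma}$ and $s_1\mathscr{L}t_{(1)\rho},\ldots,s_i\mathscr{L}t_{(i)\rho}$ in $S$; (v) $\alpha_S\mathscr{J}\beta_S$ in $\mathscr{I}_\lambda^n(S)$ if and only if there exists a permutation $\pi$ of $\{1,\ldots,i\}$ such that $s_1\mathscr{J}t_{(1)\pi},\ldots,s_i\mathscr{J}t_{(i)\pi}$ in $S$.
   Context: Green's relations on a semigroup $T$ ($T^1$ is $T$ with an identity adjoined if necessary): $a\mathscr{R}b$ iff $aT^1=bT^1$; $a\mathscr{L}b$ iff $T^1a=T^1b$; $a\mathscr{J}b$ iff $T^1aT^1=T^1bT^1$; $\mathscr{D}=\mathscr{L}\circ\mathscr{R}=\mathscr{R}\circ\mathscr{L}$; $\mathscr{H}=\mathscr{L}\cap\mathscr{R}$. Permutations act on the right: $(l)\sigma$ is the image of $l$. $\mathscr{I}_\lambda^n$ is the semigroup of all partial injective maps $\lambda\rightharpoonup\lambda$ of rank (cardinality of the range) at most $n$, with composition $x(\alpha\beta)=(x\alpha)\beta$. The semigroup $\mathscr{I}_\lambda^n(S)$ consists of all maps $\alpha_S\colon \mathrm{Gr}(\alpha)\to S$, where $\alpha\in\mathscr{I}_\lambda^n$ and $\mathrm{Gr}(\alpha)\subset\lambda\times\lambda$ is the graph of $\alpha$; the element with empty graph is denoted $0$. A non-zero element is written $\begin{pmatrix} x_1&\cdots&x_k\\ s_1&\cdots&s_k\\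 y_1&\cdots&y_k\end{pmatrix}$ ($1\leqslant k\leqslant n$, the $x_l\in\lambda$ pairwise distinct, the $y_l\in\lambda$ pairwise distinct, $s_l\in S$), meaning $\alpha$ maps $x_l$ to $y_l$ and $\alpha_S$ sends $(x_l,y_l)$ to $s_l$; the order of the columns is immaterial. The product $\alpha_S\cdot\beta_S$ has as underlying partial map the composition $\alpha\beta$, and if $(a,b)\in\mathrm{Gr}(\alpha)$ is sent to $s$ by $\alpha_S$ and $(b,d)\in\mathrm{Gr}(\beta)$ is sent to $t$ by $\beta_S$, then $\alpha_S\cdot\beta_S$ sends $(a,d)$ to $st$; in particular the product is $0$ if $\alpha\beta$ is empty.
   Formalization: In (iv) the conditions a_l = c_{(l)σ} and b_l = d_{(l)ρ} are added, since without them the ''if'' part fails, e.g. for (x;1;x) and (y;1;y) with x ≠ y; S and λ are taken with decidable equality and a choice function, which every set has classically. *)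

(* Defs.v *)
From HB Require Import structures.
From mathcomp Require Import all_boot all_fingroup finmap.

Set Implicit Arguments.
Unset Strict Implicit.
Unset Printing Implicit Defensive.

Local Open Scope group_scope.
Local Open Scope fset_scope.

Section Green.
Variable T : semigroupType.
Implicit Types a b x : T.

(* [option T] stands for T^1, [None] being the adjoined identity.  If T already
   has an identity e, then [None] and [Some e] act on T in the same way, so
   adjoining a superfluous identity does not change the sets below. *)
Definition actr a (u : option T) : T := if u is Some t then a * t else a.
Definition actl (u : option T) a : T := if u is Some t then t * a else a.

Definition rideal a x : Prop := exists u, x = actr a u.
Definition lideal a x : Prop := exists u, x = actl u a.
Definition ideal a x : Prop := exists u v, x = actr (actl u a) v.

Definition green_R a b : Prop := forall x, rideal a x <-> rideal b x.
Definition green_L a b : Prop := forall x, lideal a x <-> lideal b x.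
Definition green_J a b : Prop := forall x, ideal a x <-> ideal b x.
Definition green_D a b : Prop := exists c, green_L a c /\ green_R c b.
Definition green_H a b : Prop := green_L a b /\ green_R a b.

End Green.

Section LabelledPartialMaps.
Variables (L : choiceType) (S : semigroupType).

(* A map Gr(alpha) -> S with alpha a partial map L -> L of finite domain:
   [f x = Some (y, s)] means that alpha sends x to y and that the pair (x, y)
   of Gr(alpha) is sent to s; [f x = None] means that x is not in the domain
   of alpha. *)
Local Notation lmap := {fsfun L -> option (L * S) with None}.

Implicit Types f g h : lmap.

Definition underlying f (x : L) : option L := omap fst (f x).

Definition lmap_inj f : bool :=
  [forall x : finsupp f, forall y : finsupp f,
     (underlying f (val x) == underlying f (val y)) ==> (x == y)].

Definition lmap_range f : {fset L} :=
  [fset y in pmap (underlying f) (finsupp f)].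

Definition lmap_rank f : nat := #|` lmap_range f|.

Definition lmap_comp f g (x : L) : option (L * S) :=
  if f x is Some (y, s) then
    if g y is Some (z, t) then Some (z, s * t) else None
  else None.

Definition lmap_mul f g : lmap :=
  [fsfun x in finsupp f => lmap_comp f g x | None].

Lemma lmap_mulE f g x : lmap_mul f g x = lmap_comp f g x.
Proof.
rewrite fsfunE; case: ifPn => // xf.
by rewrite /lmap_comp (fsfun_dflt xf).
Qed.

Lemma lmap_mulA : associative lmap_mul.
Proof.
move=> f g h; apply/fsfunP => x; rewrite !lmap_mulE /lmap_comp !lmap_mulE.
rewrite /lmap_comp; case: (f x) => [[y s]|] //; rewrite lmap_mulE /lmap_comp.
case: (g y) => [[z t]|] //.
by case: (h z) => [[w u]|] //; rewrite mulgA.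
Qed.

Lemma mem_finsupp_lmap f x : (x \in finsupp f) = f x :> bool.
Proof. by rewrite mem_finsupp; case: (f x). Qed.

Lemma lmap_injP f :
  reflect (forall x x' y s s',
             f x = Some (y, s) -> f x' = Some (y, s') -> x = x')
          (lmap_inj f).
Proof.
apply: (iffP forallP) => [injf x x' y s s' fx fx'|injf x].
  have xf : x \in finsupp f by rewrite mem_finsupp_lmap fx.
  have x'f : x' \in finsupp f by rewrite mem_finsupp_lmap fx'.
  have /forallP/(_ [` x'f]) := injf [` xf].
  by rewrite /underlying /= fx fx' eqxx => /eqP[].
apply/forallP => x'; apply/implyP.
have := valP x; have := valP x'; rewrite !mem_finsupp_lmap /underlying.
case fx': (f (val x')) => [[y' s']|] // _.
case fx: (f (val x)) => [[y s]|] // _ /= /eqP[eyy'].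
by apply/eqP/val_inj; apply: injf fx _; rewrite eyy'; apply: fx'.
Qed.

Lemma lmap_rangeP f y :
  reflect (exists x s, f x = Some (y, s)) (y \in lmap_range f).
Proof.
rewrite /lmap_range !inE mem_pmap; apply: (iffP mapP) => [[x _]|[x [s fx]]].
  rewrite /underlying; case fx: (f x) => [[z s]|] //= [->].
  by exists x, s.
by exists x; rewrite /underlying ?fx // mem_finsupp_lmap fx.
Qed.

Lemma lmap_mul_inj f g : lmap_inj f -> lmap_inj g -> lmap_inj (lmap_mul f g).
Proof.
move=> /lmap_injP injf /lmap_injP injg; apply/lmap_injP => x x' z u u'.
rewrite !lmap_mulE /lmap_comp.
case fx: (f x) => [[y s]|] //; case gy: (g y) => [[w t]|] // [<- _].
case fx': (f x') => [[y' s']|] //; case gy': (g y') => [[w' t']|] // [ew _].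
rewrite ew in gy'; rewrite (injg _ _ _ _ _ gy' gy) in fx'.
exact: injf fx fx'.
Qed.

Lemma lmap_mul_rank f g : lmap_rank (lmap_mul f g) <= lmap_rank g.
Proof.
apply/fsubset_leq_card/fsubsetP => z /lmap_rangeP[x [u]].
rewrite lmap_mulE /lmap_comp; case: (f x) => [[y s]|] //.
case gy: (g y) => [[w t]|] // [<- _].
by apply/lmap_rangeP; exists y, t.
Qed.

End LabelledPartialMaps.

Section SymInvSemigroup.
Variables (L : choiceType) (S : semigroupType) (n : nat).

(* The semigroup I_L^n(S).  Finite support loses nothing: a partial injective map
   of finite rank has a finite domain. *)
Record symn := Symn {
  symn_map :> {fsfun L -> option (L * S) with None};
  symn_prop : lmap_inj symn_map && (lmap_rank symn_map <= n) }.

HB.instance Definition _ := [isSub for symn_map].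
HB.instance Definition _ := [Choice of symn by <:].

Lemma symn_mul_prop (f g : symn) :
  lmap_inj (lmap_mul f g) && (lmap_rank (lmap_mul f g) <= n).
Proof.
have /andP[injf _] := symn_prop f; have /andP[injg rkg] := symn_prop g.
by rewrite lmap_mul_inj // (leq_trans (lmap_mul_rank _ _)).
Qed.

Definition symn_mul (f g : symn) : symn := Symn (symn_mul_prop f g).

Lemma symn_mulA : associative symn_mul.
Proof. by move=> f g h; apply: val_inj; apply: lmap_mulA. Qed.

HB.instance Definition _ := isSemigroup.Build symn symn_mulA.

Lemma symn_mulP (f g : symn) x z u :
  symn_map (f * g) x = Some (z, u) <->
  exists y s t, [/\ f x = Some (y, s), g y = Some (z, t) & u = s * t].
Proof.
rewrite /mul /= lmap_mulE /lmap_comp; split=> [|[y [s [t [-> -> ->]]]] //].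
case fx: (f x) => [[y s]|] //; case gy: (g y) => [[w t]|] // [<- <-].
by exists y, s, t.
Qed.

(* f is the element written as the matrix with the columns (a l, s l, b l),
   where l ranges over 'I_i. *)
Definition has_columns (f : symn) (i : nat)
    (a : 'I_i -> L) (s : 'I_i -> S) (b : 'I_i -> L) : Prop :=
  [/\ injective a, injective b &
      forall x y t,
        f x = Some (y, t) <-> exists l, [/\ x = a l, t = s l & y = b l]].

Lemma has_columns_exists i (a : 'I_i -> L) (s : 'I_i -> S) (b : 'I_i -> L) :
  i <= n -> injective a -> injective b -> exists f, has_columns f a s b.
Proof.
move=> lein inja injb.
pose F x := omap (fun l => (b l, s l)) [pick l | a l == x].
pose f : {fsfun L -> option (L * S) with None} :=
  [fsfun x in [fset a l | l in 'I_i] => F x | None].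
have fP x y t :
    f x = Some (y, t) <-> exists l, [/\ x = a l, t = s l & y = b l].
  rewrite fsfunE /F; split=> [|[l [-> -> ->]]].
    case: ifP => // _; case: pickP => [l /eqP <-|] //= [<- <-].
    by exists l.
  rewrite in_imfset //=; case: pickP => [l' /eqP /inja -> //|].
  by move=> /(_ l); rewrite eqxx.
have Pf : lmap_inj f && (lmap_rank f <= n).
  apply/andP; split.
    apply/lmap_injP => x x' y t t' /fP[l [-> _ ->]] /fP[l' [-> _]].
    by move/injb ->.
  apply: leq_trans lein; rewrite -[i in _ <= i]card_ord cardE.
  rewrite -(size_map b); have -> : lmap_rank f = size (lmap_range f) by [].
  apply: uniq_leq_size => [|y /lmap_rangeP[x [t /fP[l [_ _ ->]]]]].
    exact: fset_uniq.
  by rewrite map_f // mem_enum.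
by exists (Symn Pf); split.
Qed.

Lemma nonzero_has_columns (f : symn) :
  (exists x, f x <> None) ->
  exists i (a : 'I_i -> L) (s : 'I_i -> S) (b : 'I_i -> L),
    0 < i <= n /\ has_columns f a s b.
Proof.
move=> [x0 fx0]; have /andP[/lmap_injP injf rkf] := symn_prop f.
case fx0E: (f x0) => [p0|] // {fx0}.
have supp_nth (l : 'I_(size (finsupp f))) : nth x0 (finsupp f) l \in finsupp f.
  exact: mem_nth.
set i := size (finsupp f) in supp_nth *.
pose a (l : 'I_i) := nth x0 (finsupp f) l.
pose p l := odflt p0 (f (a l)).
have fa l : f (a l) = Some (p l).
  by have := supp_nth l; rewrite mem_finsupp_lmap /p /a; case: (f _).
have inja : injective a.
  move=> l l' /eqP; rewrite nth_uniq ?fset_uniq // => /eqP.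
  exact: val_inj.
pose b l := (p l).1; pose s l := (p l).2.
have fab l : f (a l) = Some (b l, s l) by rewrite fa /b /s; case: (p l).
have injb : injective b.
  by move=> l l' ebl; apply/inja/(injf _ _ (b l) (s l) (s l')); rewrite // ebl.
exists i, a, s, b; split; last first.
  split=> // x y t; split=> [fx|[l [-> -> ->]] //].
  have xf : x \in finsupp f by rewrite mem_finsupp_lmap fx.
  have lti : (index x (finsupp f) < i)%N by rewrite index_mem.
  have ax : a (Ordinal lti) = x by rewrite /a /= nth_index.
  exists (Ordinal lti); rewrite ax; have := fab (Ordinal lti).
  by rewrite ax fx => -[-> ->].
apply/andP; split.
  have : x0 \in finsupp f by rewrite mem_finsupp_lmap fx0E.
  by rewrite -index_mem; apply: leq_ltn_trans.
apply: leq_trans rkf; rewrite -[i]card_ord cardE -(size_map b).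
apply: uniq_leq_size => [|y /mapP[l _ ->]].
  by rewrite (map_inj_uniq injb) enum_uniq.
by apply/lmap_rangeP; exists (a l), (s l).
Qed.

End SymInvSemigroup.

(* Main.v *)
Require Import Defs.
From mathcomp Require Import all_boot all_fingroup finmap.

(** Columns of an element of the semigroup are determined up to a permutation
    of the indices, and multiplication composes them: a factor on the right
    replaces [s l, b l] by [s l * u l, d l] and leaves the [a l] alone, a
    factor on the left does the mirror image.

    Hence multiplying on the right by an element with columns [(b l, u l, d l)]
    realises any simultaneous right multiplication of the labels together with
    any change of the lower row; such an element has rank [i], hence lies in the
    semigroup because [i <= n].  Conversely, if [alpha] and [beta] are right multiples of
    each other, no column is lost, so they have the same upper row, and the
    labels standing over equal points are right multiples of each other
    ([green_R_columns], [columns_green_R]).  This is the description of R; the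
    one of L is dual.  H is the conjunction of the two.  For D, the intermediate
    element is the one with the lower row of [alpha], the upper row of [beta]
    and intermediate labels.

    For J, an equation [alpha = u * beta * v] yields a permutation [pi] with
    [s l] in the ideal of [t (pi l)], and [beta = u' * alpha * v'] yields some
    [rho] with [t l] in the ideal of [s (rho l)], but the two permutations need
    not be inverse to each other.  Following [s l], [t (pi l)], [s (rho (pi l))]
    and so on, the ideals grow, and the sequence returns to [s l] because the
    permutation [pi * rho] has finite order; so they are all equal
    ([perm_antisym]). *)

(** * Green's relations by plain multiples *)

Section GreenMultiples.
Set Implicit Arguments.
Unset Strict Implicit.
Local Open Scope group_scope.
Variable T : semigroupType.
Implicit Types f g e : T.

(** A one-sided identity of [f] stands in for the adjoined identity of [T^1]
    in the ideals of [f] and also in those of [g]: when [f] equals [g], the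
    identity of [f] is one of [g]. *)
Lemma green_RP f g e : f * e = f ->
  green_R f g <-> (exists u, g = f * u) /\ (exists v, f = g * v).
Proof.
move=> fe; split=> [fRg|[[u gE] [v fE]] x].
  have [w gE] : rideal f g by apply/fRg; exists None.
  have [z fE] : rideal g f by apply/fRg; exists None.
  split; first by case: w gE => [u ->|->]; [exists u | exists e].
  by case: z fE => [v ->|/= fg]; [exists v | exists e; rewrite -fg].
split=> -[[w|] ->] /=.
- by exists (Some (v * w)); rewrite /= mulgA -fE.
- by exists (Some v).
- by exists (Some (u * w)); rewrite /= mulgA -gE.
- by exists (Some u).
Qed.

Lemma green_LP f g e : e * f = f ->
  green_L f g <-> (exists u, g = u * f) /\ (exists v, f = v * g).
Proof.
move=> ef; split=> [fLg|[[u gE] [v fE]] x].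
  have [w gE] : lideal f g by apply/fLg; exists None.
  have [z fE] : lideal g f by apply/fLg; exists None.
  split; first by case: w gE => [u ->|->]; [exists u | exists e].
  by case: z fE => [v ->|/= fg]; [exists v | exists e; rewrite -fg].
split=> -[[w|] ->] /=.
- by exists (Some (w * v)); rewrite /= -mulgA -fE.
- by exists (Some v).
- by exists (Some (w * u)); rewrite /= -mulgA -gE.
- by exists (Some u).
Qed.

Lemma idealP f g e e' : e * f = f -> f * e' = f ->
  ideal f g <-> exists u v, g = u * f * v.
Proof.
move=> ef fe'; split=> [[w [z ->]]|[u [v ->]]]; last by exists (Some u), (Some v).
case: w z => [u|] [v|] /=.
- by exists u, v.
- by exists u, e'; rewrite -mulgA fe'.
- by exists e, v; rewrite ef.
- by exists e, e'; rewrite ef fe'.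
Qed.

Lemma ideal_refl f : ideal f f.
Proof. by exists None, None. Qed.

Lemma ideal_trans f g h : ideal f g -> ideal g h -> ideal f h.
Proof.
move=> [w [z ->]] [w' [z' ->]].
exists (if w' is Some p then if w is Some q then Some (p * q) else w' else w).
exists (if z' is Some p then if z is Some q then Some (q * p) else z' else z).
by case: w w' z z' => [u|] [u'|] [v|] [v'|]; rewrite /= ?mulgA.
Qed.

Lemma green_JP f g : green_J f g <-> ideal f g /\ ideal g f.
Proof.
split=> [fJg|[fg gf] x]; last by split; apply: ideal_trans.
by split; apply/fJg; apply: ideal_refl.
Qed.

End GreenMultiples.

(** * Finite permutations *)

Section FinitePermutations.
Set Implicit Arguments.
Local Open Scope group_scope.

(** The chain starting at [s l] increases along the cycle of [pi * rho], hence
    is constant up to equivalence. *)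
Lemma perm_antisym (X : Type) (le : X -> X -> Prop) (I : finType)
    (s t : I -> X) (pi rho : {perm I}) :
  (forall x, le x x) -> (forall y x z, le x y -> le y z -> le x z) ->
  (forall l, le (s l) (t (pi l))) -> (forall l, le (t l) (s (rho l))) ->
  forall l, le (t (pi l)) (s l).
Proof.
move=> le_refl le_trans st ts l; pose tau := pi * rho.
have s_tau m : le (s m) (s (tau m)).
  by rewrite permM; apply: le_trans (ts _).
have s_iter k m : le (s m) (s ((tau ^+ k) m)).
  elim: k => [|k IHk]; first by rewrite expg0 perm1.
  by rewrite expgSr permM; apply: le_trans (s_tau _).
apply: le_trans (ts _) _; have := s_iter #[tau].-1 (tau l).
by rewrite -permM -expgS prednK ?order_gt0 // expg_order perm1 permM.
Qed.

End FinitePermutations.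

(** * Columns *)

Section Columns.
Set Implicit Arguments.
Unset Strict Implicit.
Local Open Scope group_scope.
Variables (S : monoidType) (L : choiceType) (n i : nat).
Implicit Types (f g : symn L S n) (a b c d : 'I_i -> L) (s t : 'I_i -> S).

Lemma symn_inj f x x' y (r r' : S) :
  f x = Some (y, r) -> f x' = Some (y, r') -> x = x'.
Proof. by have /andP[/lmap_injP injf _] := symn_prop f; apply: injf. Qed.

Lemma columns_val f a s b l : has_columns f a s b -> f (a l) = Some (b l, s l).
Proof. by case=> _ _ fE; apply/fE; exists l. Qed.

Lemma columns_eq f g a s t b :
  has_columns f a s b -> has_columns g a t b -> s =1 t -> f = g.
Proof.
move=> fC gC st; have [_ _ fE] := fC; have [_ _ gE] := gC.
apply/val_inj/fsfunP => x /=.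
case fx: (symn_map f x) => [[y r]|].
  by have [l [-> -> ->]] := (fE _ _ _).1 fx; rewrite st (columns_val l gC).
case gx: (symn_map g x) => [[y r]|] //; have [l [xE _ _]] := (gE _ _ _).1 gx.
by move: fx; rewrite xE (columns_val l fC).
Qed.

Lemma columns_mul f g a s b (u : 'I_i -> S) d :
  has_columns f a s b -> has_columns g b u d ->
  has_columns (f * g) a (fun l => s l * u l) d.
Proof.
move=> fC gC; have [inja injb fE] := fC; have [_ injd gE] := gC.
split=> // x z r; split=> [/symn_mulP[y [p [q [/fE[l [-> -> ->]]]]]]|].
  by rewrite (columns_val _ gC) => -[<- <-] ->; exists l.
move=> [l [-> -> ->]]; apply/symn_mulP; exists (b l), (s l), (u l).
by rewrite (columns_val _ fC) (columns_val _ gC).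
Qed.

Lemma columns_perm f a s b (sigma : 'S_i) : has_columns f a s b ->
  has_columns f (fun l => a (sigma l)) (fun l => s (sigma l))
                (fun l => b (sigma l)).
Proof.
move=> [inja injb fE]; split.
- by move=> l l' /inja/perm_inj.
- by move=> l l' /injb/perm_inj.
move=> x y r; split=> [/fE[l [-> -> ->]]|[l E]]; last by apply/fE; exists (sigma l).
by exists (sigma^-1 l); rewrite permKV.
Qed.

Lemma columns_unique f a s b c t d :
  has_columns f a s b -> has_columns f c t d ->
  exists sigma : 'S_i, forall l,
    [/\ a l = c (sigma l), s l = t (sigma l) & b l = d (sigma l)].
Proof.
move=> fC [_ _ fE'].
have /fin_all_exists[sigma sigmaE] l :
    exists m, [/\ a l = c m, s l = t m & b l = d m].
  exact/fE'/(columns_val _ fC).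
have inj_sigma : injective sigma.
  move=> l l' E; have [inja _ _] := fC; apply: inja.
  by have [-> _ _] := sigmaE l; have [-> _ _] := sigmaE l'; rewrite E.
by exists (perm inj_sigma) => l; rewrite permE.
Qed.

Hypothesis le_i_n : i <= n.

(** The local identities are the labelled identities of the two rows. *)
Lemma columns_ridentity f a s b : has_columns f a s b -> exists e, f * e = f.
Proof.
move=> fC; have [_ injb _] := fC.
have [e eC] := has_columns_exists (fun=> 1 : S) le_i_n injb injb.
by exists e; apply: columns_eq (columns_mul fC eC) fC _ => l; rewrite mulg1.
Qed.

Lemma columns_lidentity f a s b : has_columns f a s b -> exists e, e * f = f.
Proof.
move=> fC; have [inja _ _] := fC.
have [e eC] := has_columns_exists (fun=> 1 : S) le_i_n inja inja.
by exists e; apply: columns_eq (columns_mul eC fC) fC _ => l; rewrite mul1g.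
Qed.

(** * R and L *)

(** Column [l] of [g] is read off from [f = g * v]; [v] is a map, so it keeps
    the new lower points distinct, and [g = f * u] has no columns outside the
    upper row of [f]. *)
Lemma green_R_columns f g a s b : has_columns f a s b -> green_R f g ->
  exists t d, has_columns g a t d /\ forall l, green_R (s l) (t l).
Proof.
move=> fC; have [e fe] := columns_ridentity fC.
move=> /(green_RP _ fe)[[u gE] [v fE]]; have [inja injb fP] := fC.
have /fin_all_exists[p pP] l : exists p : L * S,
    [/\ g (a l) = Some p, exists q, v p.1 = Some (b l, q) & green_R (s l) p.2].
  have := columns_val l fC; rewrite {1}fE => /symn_mulP[y [r [q [gal vy sE]]]].
  exists (y, r); split=> //; first by exists q.
  move: gal; rewrite gE => /symn_mulP[z [w [k [fal _ rE]]]].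
  move: fal; rewrite (columns_val l fC) => -[_ sw].
  apply/(green_RP _ (mulg1 _)); split; last by exists q.
  by exists k; rewrite sw.
exists (fun l => (p l).2), (fun l => (p l).1); split;
  last by move=> l; have [] := pP l.
split=> // [l l' El|x y r].
  have [_ [q vl] _] := pP l; have [_ [q' vl'] _] := pP l'.
  by apply: injb; move: vl; rewrite /= in El; rewrite El vl' => -[].
have gp l : g (a l) = Some ((p l).1, (p l).2).
  by have [-> _ _] := pP l; case: (p l).
split=> [gx|[l [-> -> ->]] //].
have := gx; rewrite gE => /symn_mulP[z [w [k [/fP[l [xE _ _]] _ _]]]].
by exists l; move: gx; rewrite xE gp => -[<- <-].
Qed.

(** Here the upper rows are the unknown ones: the point of [g] that a factor
    [v] with [f = v * g] reads in column [l] is the one that [g] sends to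
    [b l]. *)
Lemma green_L_columns f g a s b : has_columns f a s b -> green_L f g ->
  exists c t, has_columns g c t b /\ forall l, green_L (s l) (t l).
Proof.
move=> fC; have [e ef] := columns_lidentity fC.
move=> /(green_LP _ ef)[[u gE] [v fE]]; have [inja injb fP] := fC.
have /fin_all_exists[p pP] l : exists p : L * S,
    g p.1 = Some (b l, p.2) /\ green_L (s l) p.2.
  have := columns_val l fC; rewrite {1}fE => /symn_mulP[x [q [r [_ gx sE]]]].
  exists (x, r); split=> //.
  move: gx; rewrite gE => /symn_mulP[z [k [w [_ /fP[l' [_ wE bE]] rE]]]].
  apply/(green_LP _ (mul1g _)); split; last by exists q.
  by exists k; rewrite rE wE (injb _ _ bE).
exists (fun l => (p l).1), (fun l => (p l).2); split;
  last by move=> l; have [] := pP l.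
have gp l : g (p l).1 = Some (b l, (p l).2) by have [] := pP l.
split=> // [l l' El|x y r].
  by apply: injb; have := gp l; rewrite /= in El; rewrite El gp => -[].
split=> [gx|[l [-> -> ->]] //].
have := gx; rewrite gE => /symn_mulP[z [k [w [_ /fP[l [_ _ yE]] _]]]].
exists l; move: gx; rewrite yE => gx; have xE := symn_inj gx (gp l).
by move: gx; rewrite xE gp => -[<-].
Qed.

Lemma columns_green_R f g a s b t d :
  has_columns f a s b -> has_columns g a t d ->
  (forall l, green_R (s l) (t l)) -> green_R f g.
Proof.
move=> fC gC st; have [_ injb _] := fC; have [_ injd _] := gC.
have {}st l := (green_RP (t l) (mulg1 (s l))).1 (st l).
have /fin_all_exists[u tE] l : exists u, t l = s l * u by have [] := st l.
have /fin_all_exists[v sE] l : exists v, s l = t l * v by have [] := st l.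
have [hu huC] := has_columns_exists u le_i_n injb injd.
have [hv hvC] := has_columns_exists v le_i_n injd injb.
have [e fe] := columns_ridentity fC; apply/(green_RP _ fe); split.
  by exists hu; apply: columns_eq gC (columns_mul fC huC) tE.
by exists hv; apply: columns_eq fC (columns_mul gC hvC) sE.
Qed.

Lemma columns_green_L f g a s b c t :
  has_columns f a s b -> has_columns g c t b ->
  (forall l, green_L (s l) (t l)) -> green_L f g.
Proof.
move=> fC gC st; have [inja _ _] := fC; have [injc _ _] := gC.
have {}st l := (green_LP (t l) (mul1g (s l))).1 (st l).
have /fin_all_exists[u tE] l : exists u, t l = u * s l by have [] := st l.
have /fin_all_exists[v sE] l : exists v, s l = v * t l by have [] := st l.
have [hu huC] := has_columns_exists u le_i_n injc inja.
have [hv hvC] := has_columns_exists v le_i_n inja injc.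
have [e ef] := columns_lidentity fC; apply/(green_LP _ ef); split.
  by exists hu; apply: columns_eq gC (columns_mul huC fC) tE.
by exists hv; apply: columns_eq fC (columns_mul hvC gC) sE.
Qed.

Variables (f g : symn L S n) (a b c d : 'I_i -> L) (s t : 'I_i -> S).
Hypotheses (fC : has_columns f a s b) (gC : has_columns g c t d).

Lemma green_R_perm : green_R f g <->
  exists sigma : 'S_i, (forall l, a l = c (sigma l)) /\
                       (forall l, green_R (s l) (t (sigma l))).
Proof.
split=> [fRg|[sigma [ac st]]].
  have [t' [d' [gC' st']]] := green_R_columns fC fRg.
  have [sigma sigmaE] := columns_unique gC' gC.
  exists sigma; split=> l; have [acE tE _] := sigmaE l => //.
  by rewrite -tE.
have fC' : has_columns f (fun l => c (sigma l)) s b.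
  have [inja injb fE] := fC; split=> [l l'|//|x y r].
    by rewrite -!ac => /inja.
  by rewrite fE; split=> -[l [-> -> ->]]; exists l; rewrite ac.
exact: columns_green_R fC' (columns_perm sigma gC) st.
Qed.

Lemma green_L_perm : green_L f g <->
  exists sigma : 'S_i, (forall l, b l = d (sigma l)) /\
                       (forall l, green_L (s l) (t (sigma l))).
Proof.
split=> [fLg|[sigma [bd st]]].
  have [c' [t' [gC' st']]] := green_L_columns fC fLg.
  have [sigma sigmaE] := columns_unique gC' gC.
  exists sigma; split=> l; have [_ tE bdE] := sigmaE l => //.
  by rewrite -tE.
have fC' : has_columns f a s (fun l => d (sigma l)).
  have [inja injb fE] := fC; split=> [//|l l'|x y r].
    by rewrite -!bd => /injb.
  by rewrite fE; split=> -[l [-> -> ->]]; exists l; rewrite bd.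
exact: columns_green_L fC' (columns_perm sigma gC) st.
Qed.

(** * D, H and J *)

Lemma green_D_perm : green_D f g <->
  exists sigma : 'S_i, forall l, green_D (s l) (t (sigma l)).
Proof.
split=> [[h [fLh hRg]]|[sigma st]].
  have [a' [r [hC sr]]] := green_L_columns fC fLh.
  have [t' [d' [gC' rt]]] := green_R_columns hC hRg.
  have [sigma sigmaE] := columns_unique gC' gC.
  exists sigma => l; exists (r l); split=> //.
  by have [_ <- _] := sigmaE l.
have [/fin_all_exists[r rP] gC'] := (st, columns_perm sigma gC).
have [[injc _ _] [_ injb _]] := (gC', fC).
have [h hC] := has_columns_exists r le_i_n injc injb.
exists h; split.
  by apply: columns_green_L fC hC _ => l; have [] := rP l.
by apply: columns_green_R hC gC' _ => l; have [] := rP l.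
Qed.

Lemma green_H_perm : green_H f g <->
  exists sigma rho : 'S_i,
    [/\ forall l, a l = c (sigma l), forall l, green_R (s l) (t (sigma l)),
        forall l, b l = d (rho l) & forall l, green_L (s l) (t (rho l))].
Proof.
split=> [[/green_L_perm[rho [bd stL]] /green_R_perm[sigma [ac stR]]]|].
  by exists sigma, rho.
move=> [sigma [rho [ac stR bd stL]]]; split.
  by apply/green_L_perm; exists rho.
by apply/green_R_perm; exists sigma.
Qed.

End Columns.

Section ColumnIdeals.
Set Implicit Arguments.
Unset Strict Implicit.
Local Open Scope group_scope.
Variables (S : monoidType) (L : choiceType) (n i : nat).
Hypothesis le_i_n : i <= n.
Variables (f g : symn L S n) (a b c d : 'I_i -> L) (s t : 'I_i -> S).
Hypotheses (fC : has_columns f a s b) (gC : has_columns g c t d).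

(** Column [l] of [f = u * g * v] is obtained from a unique column of [g];
    distinct columns of [f] use distinct columns of [g], because they end at
    distinct points and [v] is a map. *)
Lemma columns_ideal : ideal g f <->
  exists pi : 'S_i, forall l, ideal (t (pi l)) (s l).
Proof.
have [e eg] := columns_lidentity le_i_n gC.
have [e' ge'] := columns_ridentity le_i_n gC.
have [inja injb fE] := fC; have [injc injd gE] := gC.
have idealS x y := idealP y (mul1g x) (mulg1 x).
split=> [/(idealP _ eg ge')[u [v fuv]]|[pi st]].
  have /fin_all_exists[pi piP] l : exists m,
      ideal (t m) (s l) /\ exists q, v (d m) = Some (b l, q).
    have := columns_val l fC; rewrite {1}fuv => /symn_mulP[y [w [q [ugal vy sE]]]].
    have /symn_mulP[x [p [r [_ /gE[m [_ rE yE]] wE]]]] := ugal.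
    exists m; split; last by exists q; rewrite -yE.
    by apply/idealS; exists p, q; rewrite sE wE rE.
  have inj_pi : injective pi.
    move=> l l' El; have [_ [q vl]] := piP l; have [_ [q' vl']] := piP l'.
    by apply: injb; move: vl; rewrite El vl' => -[].
  by exists (perm inj_pi) => l; rewrite permE; have [] := piP l.
have /fin_all_exists[p /fin_all_exists[q sE]] l :
    exists p q, s l = p * t (pi l) * q by apply/idealS.
have gC' := columns_perm pi gC; have [injc' injd' _] := gC'.
have [u uC] := has_columns_exists p le_i_n inja injc'.
have [v vC] := has_columns_exists q le_i_n injd' injb.
apply/(idealP _ eg ge'); exists u, v.
exact: columns_eq fC (columns_mul (columns_mul uC gC') vC) sE.
Qed.

End ColumnIdeals.

Section ColumnJ.
Local Open Scope group_scope.

Lemma green_J_perm (S : monoidType) (L : choiceType) (n i : nat) (le_i_n : i <= n)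
    (f g : symn L S n) (a b c d : 'I_i -> L) (s t : 'I_i -> S)
    (fC : has_columns f a s b) (gC : has_columns g c t d) :
  green_J f g <-> exists pi : 'S_i, forall l, green_J (s l) (t (pi l)).
Proof.
split=> [/green_JP[fg gf]|[pi st]].
  have [rho ts] := (columns_ideal le_i_n gC fC).1 fg.
  have [pi st] := (columns_ideal le_i_n fC gC).1 gf.
  exists pi => l; apply/green_JP; split; last exact: st.
  apply: (perm_antisym (le := fun x y => ideal y x)) st ts l => [x|y x z xy yz].
    exact: ideal_refl.
  exact: ideal_trans yz xy.
apply/green_JP; split.
  apply/(columns_ideal le_i_n gC fC); exists pi^-1 => l.
  by have /green_JP[] := st (pi^-1 l); rewrite permKV.
apply/(columns_ideal le_i_n fC gC); exists pi => l.
by have /green_JP[] := st l.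
Qed.

End ColumnJ.

Theorem proposition3p8
    (S : monoidType) (L : choiceType) (n : nat)
    (L_nonempty : inhabited L)
    (n_gt0 : 0 < n)
    (n_le_L : exists e : 'I_n -> L, injective e)
    (i : nat) (i_range : 1 <= i <= n)
    (a : 'I_i -> L) (s : 'I_i -> S) (b : 'I_i -> L)
    (c : 'I_i -> L) (t : 'I_i -> S) (d : 'I_i -> L)
    (alpha beta : symn L S n)
    (alphaE : has_columns alpha a s b)
    (betaE : has_columns beta c t d) :
  [/\ green_R alpha beta <->
        (exists sigma : 'S_i,
           (forall l, a l = c (sigma l)) /\
           (forall l, green_R (s l) (t (sigma l)))),
      green_L alpha beta <->
        (exists sigma : 'S_i,
           (forall l, b l = d (sigma l)) /\
           (forall l, green_L (s l) (t (sigma l)))),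
      green_D alpha beta <->
        (exists sigma : 'S_i, forall l, green_D (s l) (t (sigma l))),
      green_H alpha beta <->
        (exists sigma rho : 'S_i,
           [/\ forall l, a l = c (sigma l),
               forall l, green_R (s l) (t (sigma l)),
               forall l, b l = d (rho l) &
               forall l, green_L (s l) (t (rho l))]) &
      green_J alpha beta <->
        (exists pi : 'S_i, forall l, green_J (s l) (t (pi l)))].
Proof.
have /andP[_ le_i_n] := i_range; split.
- exact: (green_R_perm le_i_n alphaE betaE).
- exact: (green_L_perm le_i_n alphaE betaE).
- exact: (green_D_perm le_i_n alphaE betaE).
- exact: (green_H_perm le_i_n alphaE betaE).
- exact: (green_J_perm le_i_n alphaE betaE).
Qed.
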